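(* Let $\Gamma=(V,E)$ be a connected graph where $V$ is countable and every vertex has finite valence, and let $d$ be the graph metric on $V$. Suppose there is a pair of vertices $a,b\in V$ such that for every $n\in\mathbb{N}$ there is a vertex $c_n\in V$ such that the triple $\{a,b,c_n\}$ has perimeter $d(a,b)+d(b,c_n)+d(c_n,a)\ge n$, and no minimal path from $a$ to $c_n$ shares a tail with a minimal path from $b$ to $c_n$. Then there is a point in the metric boundary $\partial_d V$ which is not a Busemann point.
   Context: Graphs are undirected. For a connected graph $\Gamma=(V,E)$, the graph metric $d$ on $V$ is $d(x,y)=$ the minimum length (number of edges) of a path from $x$ to $y$; a minimal path from $x$ to $y$ is a path of length $d(x,y)$. A path from $a$ to $c$ and a path from $b$ to $c$ share a tail if they have a common terminal segment of positive length ending at $c$ (i.e. the same last edge into $c$). Metric compactification: for a complete, locally compact metric space $(X,d)$, let $C_b(X)$ be the commutative unital C*-algebra of bounded continuous functions on $X$ with the uniform norm, and $C_\infty(X)$ the closed subalgebra of functions vanishing at infinity. For $y,z\in X$ let $\varphi_{y,z}(x)=d(x,y)-d(x,z)$, which lies in $C_b(X)$. Let $\mathcal{G}(X,d)$ be the closed (C*-)subalgebra of $C_b(X)$ generated by $C_\infty(X)$, the constant functions and all $\varphi_{y,z}$, $y,z\in X$. The metric compactification $\overline{X}_d$ is the maximal ideal space (Gelfand spectrum) of $\mathcal{G}(X,d)$; it is compact and contains $X$ as an open subset via point evaluations. The metric boundary is $\partial_d X=\overline{X}_d\setminus X$. For a connected graph this is applied to $X=V$ with the graph metric. Let $T$ be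 an unbounded subset of $\mathbb{R}^+=[0,\infty)$ containing $0$. A map $\gamma:T\to X$ is an almost-geodesic ray if for every $\varepsilon>0$ there is an integer $N$ such that $|d(\gamma(t),\gamma(s))+d(\gamma(s),\gamma(0))-t|<\varepsilon$ for all $t,s\in T$ with $t\ge s\ge N$. The ray $\gamma$ converges to $\omega\in\partial_d X$ if $\gamma(t)\to\omega$ in $\overline{X}_d$ as $t\to\infty$ in $T$. A point of $\partial_d X$ is a Busemann point if it is the limit of an almost-geodesic ray. *)

(* Defs.v *)
From HB Require Import structures.
From mathcomp Require Import all_boot all_order all_algebra complex.
From mathcomp Require Import all_classical all_reals all_analysis.

Set Implicit Arguments.
Unset Strict Implicit.
Unset Printing Implicit Defensive.

Import Order.TTheory GRing.Theory Num.Theory.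
Import numFieldNormedType.Exports.

Local Open Scope classical_set_scope.
Local Open Scope ring_scope.

(* R[i] under the name of an abstract numClosedFieldType, so that it receives
   the topology and norm that MathComp-Analysis attaches to such fields. *)
Definition cplx (R : realType) : numClosedFieldType := R[i].

Definition cplx_of_real (R : realType) (x : R) : cplx R := (x%:C)%C.

Section FunctionAlgebras.
Context {R : realType} (X : topologicalType).
Local Notation C := (cplx R).

Definition Cb : set (X -> C) := [set f | continuous f /\ bounded_fun f].

Definition Cinfty : set (X -> C) :=
  [set f | Cb f /\
           forall eps : C, 0 < eps -> compact [set x | eps <= `|f x|]].

(* A uniformly closed, conjugation-stable subalgebra of Cb(X).  As Cb(X) is
   itself closed for uniform convergence, closedness is expressed in the space
   of all functions. *)
Definition closed_star_subalgebra (A : set (X -> C)) : Prop :=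
  [/\ A `<=` Cb, A (cst 0) & closed (A : set {uniform X -> C})] /\
  [/\ forall f g, A f -> A g -> A (fun x => f x + g x),
      forall (a : C) f, A f -> A (fun x => a * f x),
      forall f g, A f -> A g -> A (fun x => f x * g x) &
      forall f, A f -> A (fun x => (f x)^*)].

(* Nonzero algebra homomorphisms A -> C.  The operations of A are those of
   X -> C; they are described through val to avoid membership proofs. *)
Definition character (A : set (X -> C)) : set {ptws set_type A -> C} :=
  [set chi : {ptws set_type A -> C} |
    [/\ forall f g h : A,
          (forall x, \val h x = \val f x + \val g x) -> chi h = chi f + chi g,
        forall (a : C) (f h : A),
          (forall x, \val h x = a * \val f x) -> chi h = a * chi f,
        forall f g h : A,
          (forall x, \val h x = \val f x * \val g x) -> chi h = chi f * chi g &
        exists f : A, chi f != 0]].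

(* As a subspace of {ptws A -> C}, the Gelfand spectrum carries the topology of
   pointwise convergence on A, i.e., the Gelfand (weak-star) topology. *)
Definition spectrum (A : set (X -> C)) := set_type (@character A).

End FunctionAlgebras.

Section MetricCompactification.
Context {R : realType} (X : metricType R).
Local Notation C := (cplx R).

Definition phi (y z : X) : X -> C :=
  fun x => cplx_of_real (mdist x y - mdist x z).

Definition metric_algebra : set (X -> C) :=
  smallest (@closed_star_subalgebra R X)
    (@Cinfty R X `|` range (fun c : C => cst c)
                 `|` [set phi p.1 p.2 | p in [set: X * X]]).

Definition metric_compactification := spectrum metric_algebra.

Definition eval_at (x : X) : {ptws set_type metric_algebra -> C} :=
  fun f => \val f x.

Lemma eval_at_character (x : X) : eval_at x \in @character R X metric_algebra.
Proof.
rewrite inE; split=> [f g h /(_ x)|a f h /(_ x)|f g h /(_ x)|] //.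
have A1 : cst (1 : C) \in metric_algebra.
  by rewrite inE => A [_]; apply; left; right; exists 1.
by exists (exist (fun f => f \in metric_algebra) _ A1); rewrite /eval_at /= oner_neq0.
Qed.

Definition point_evaluation (x : X) : metric_compactification :=
  exist _ (eval_at x) (eval_at_character x).

Definition metric_boundary : set metric_compactification :=
  ~` range point_evaluation.

(* gamma is a total function, but only its values on T are relevant. *)
Definition almost_geodesic_ray (T : set R) (gamma : R -> X) : Prop :=
  [/\ T `<=` [set t | 0 <= t], T 0, (forall M, exists2 t, T t & M < t) &
      forall eps : R, 0 < eps -> exists N : int, forall t s : R,
        T t -> T s -> s <= t -> N%:~R <= s ->
        `|mdist (gamma t) (gamma s) + mdist (gamma s) (gamma 0) - t| < eps].

Definition ray_converges (T : set R) (gamma : R -> X)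
    (omega : metric_compactification) : Prop :=
  point_evaluation (gamma t) @[t --> within T (pinfty_nbhs R)] --> omega.

Definition busemann_point (omega : metric_compactification) : Prop :=
  metric_boundary omega /\
  exists (T : set R) (gamma : R -> X),
    almost_geodesic_ray T gamma /\ ray_converges T gamma omega.

End MetricCompactification.

Record connected_graph (V : choiceType) := ConnectedGraph {
  adj :> rel V;
  adj_sym : symmetric adj;
  adj_connected : forall x y, exists2 p, path adj x p & last x p = y
}.

Section GraphMetric.
Local Open Scope nat_scope.
Context {V : choiceType} (G : connected_graph V).

(* A path from x is x :: p with path G x p; its number of edges is size p. *)
Definition path_length (x y : V) (n : nat) : bool :=
  `[< exists p, [/\ path G x p, last x p = y & size p = n] >].

Lemma path_length_ex x y : exists n, path_length x y n.
Proof.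
by have [p xp py] := adj_connected G x y; exists (size p);
  apply/asboolP; exists p.
Qed.

Definition gdist (x y : V) : nat := ex_minn (path_length_ex x y).

Definition minimal_path (x y : V) (p : seq V) : Prop :=
  [/\ path G x p, last x p = y & size p = gdist x y].

(* On whole vertex sequences: a common terminal segment with at least one edge,
   i.e., at least two vertices. *)
Definition share_tail (s t : seq V) : Prop :=
  exists u, [/\ 1 < size u, suffix u s & suffix u t].

Lemma gdist_le x p : path G x p -> gdist x (last x p) <= size p.
Proof.
rewrite /gdist; case: ex_minnP => m _ mmin xp.
by apply: mmin; apply/asboolP; exists p.
Qed.

Lemma gdist_path x y : exists p, minimal_path x y p.
Proof.
rewrite /minimal_path /gdist.
by case: ex_minnP => m /asboolP[p [xp py pm]] _; exists p.
Qed.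

Lemma gdistxx x : gdist x x = 0.
Proof. by apply/eqP; rewrite -leqn0 (@gdist_le x [::]). Qed.

Lemma gdist_eq0 x y : gdist x y = 0 -> x = y.
Proof. by have [[|? ?] [_ <- <-]] := gdist_path x y. Qed.

Lemma gdist_sym x y : gdist x y = gdist y x.
Proof.
have le u v : gdist u v <= gdist v u.
  have [p [vp pu <-]] := gdist_path v u.
  have := rev_path G v p; rewrite pu.
  rewrite (eq_path (fun a b => adj_sym G b a)) vp => up.
  have := gdist_le up; rewrite size_rev size_belast.
  suff -> : last u (rev (belast v p)) = v by [].
  by case: (p) pu => [<- //|w q _]; rewrite /= rev_cons last_rcons.
by apply/eqP; rewrite eqn_leq !le.
Qed.

Lemma gdist_triangle y x z : gdist x z <= gdist x y + gdist y z.
Proof.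
have [p [xp py <-]] := gdist_path x y; have [q [yq qz <-]] := gdist_path y z.
have := @gdist_le x (p ++ q); rewrite last_cat cat_path py xp yq qz size_cat.
exact.
Qed.

End GraphMetric.

Definition locally_finite (V : choiceType) (G : connected_graph V) : Prop :=
  forall x : V, finite_set [set y | G x y].

(* The vertices of G as a metric space; R is a parameter of the type because a
   metricType R instance determines the topology of its carrier. *)
Definition graph_space (R : realType) (V : choiceType) (G : connected_graph V)
  : Type := V.

Section GraphSpace.
Context (R : realType) (V : choiceType) (G : connected_graph V).

HB.instance Definition _ := Choice.on (graph_space R G).

Let dist (x y : graph_space R G) : R := (gdist G x y)%:R.

Let dist_xx x : dist x x = 0.
Proof. by rewrite /dist gdistxx. Qed.

Let dist_eq0 x y : dist x y = 0 -> x = y.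
Proof. by move/eqP; rewrite pnatr_eq0 => /eqP /gdist_eq0. Qed.

Let dist_sym x y : dist x y = dist y x.
Proof. by rewrite /dist gdist_sym. Qed.

Let dist_triangle y x z : dist x z <= dist x y + dist y z.
Proof. by rewrite -natrD ler_nat gdist_triangle. Qed.

HB.instance Definition _ := @isMetric.Build R (graph_space R G)
  dist dist_xx dist_eq0 dist_sym dist_triangle.

End GraphSpace.

(* Main.v *)
Require Import Defs.
From HB Require Import structures.
From mathcomp Require Import all_boot all_order all_algebra complex.
From mathcomp Require Import all_classical all_reals all_analysis.
From mathcomp Require Import ring lra zify.

Set Implicit Arguments.
Unset Strict Implicit.
Unset Printing Implicit Defensive.

Import Order.TTheory GRing.Theory Num.Theory.
Import numFieldNormedType.Exports.

Local Open Scope classical_set_scope.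
Local Open Scope ring_scope.

(** The boundary point is any limit omega of the vertices c_n in the metric
compactification; what has to be seen is that no almost-geodesic ray gamma can
converge to the same omega.

Graph distances are integers, so the functions phi y z take integer values, and
closeness within 1 means equality.  Hence the almost-geodesic condition becomes
an exact one, d(gamma t, gamma 0) = d(gamma t, gamma s) + d(gamma s, gamma 0)
for large s <= t (almost_geodesic_gdist), and a function phi y z takes, at all
c_n close to omega, the very value that it takes on gamma far along the ray.
Combining the two (geodesic_toward_limit): for each base vertex a, every
far vertex x = gamma s lies on a minimal path from a to c_n, for the c_n close
enough to omega.  Apply this to both a and b and choose one x that serves for
the two of them.  A minimal path from x to c_n then completes minimal paths
a -> x and b -> x, and it has positive length since the c_n leave every vertex;
so minimal paths from a and from b to c_n share a tail, which is excluded.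

The point omega is constructed without compactness of the spectrum: fix an
ultrafilter U that contains all tails of (c_n), and let omega f be the limit of
f along U.  Every f in the metric algebra is bounded, being in Cb
(metric_algebra_Cb), so that the limit exists (cplx_ultra_cvg); limits respect
the algebra operations, so omega is a character (ultra_eval_character).  It is
not the evaluation at a vertex x, because the indicator function of x is in the
algebra and tends to 0 along U (ultra_point_boundary).  The c_n close
to omega are then those in a suitable set of U; several such sets, together with
the range of (c_n), have a common element, because U is a proper filter. *)

(** * Limits along ultrafilters and complex numbers *)

(** An ultrafilter decides every set: if the preimage of a neighbourhood of the
cluster point p were not in U, its complement would be, and would have to meet
that neighbourhood. *)
Lemma ultra_cluster_cvg (T : Type) (Y : topologicalType) (U : set_system T)
    (UU : UltraFilter U) (f : T -> Y) (p : Y) :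
  cluster (f @ U) p -> f @ U --> p.
Proof.
move=> clp B Bp; have [//|UnB] := in_ultra_setVsetC (f @^-1` B) UU.
by have [y []] := clp (~` B) B UnB Bp.
Qed.

Lemma ultra_bounded_cvg (R : realType) (T : Type) (U : set_system T)
    (UU : UltraFilter U) (g : T -> R) (m : R) :
  (forall x, `|g x| <= m) -> exists l : R, g @ U --> l.
Proof.
move=> gm.
have gU : (g @ U) [set` `[- m, m]].
  by apply: (@filterE _ U) => x /=; rewrite in_itv /= -ler_norml.
have [l [_ cl]] := @segment_compact R (- m) m (g @ U) _ gU.
by exists l; exact: ultra_cluster_cvg.
Qed.

Section ComplexNumbers.
Context {R : realType}.
Local Notation C := (cplx R).

Lemma cplx_norm_real (x : R) : `|cplx_of_real x| = cplx_of_real `|x|.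
Proof. by rewrite /cplx_of_real normc_def /= expr0n addr0 sqrtr_sqr. Qed.

Lemma cplx_norm_i : `|'i%C : C| = 1.
Proof. by rewrite normc_def /= expr0n add0r expr1n sqrtr1. Qed.

Lemma cplx_of_realD (x y : R) :
  cplx_of_real (x + y) = cplx_of_real x + cplx_of_real y.
Proof. exact: rmorphD. Qed.

Lemma cplx_of_realB (x y : R) :
  cplx_of_real (x - y) = cplx_of_real x - cplx_of_real y.
Proof. exact: rmorphB. Qed.

Lemma cplx_of_realM (x y : R) :
  cplx_of_real (x * y) = cplx_of_real x * cplx_of_real y.
Proof. exact: rmorphM. Qed.

Lemma ler_cplx (x y : R) : (cplx_of_real x <= cplx_of_real y) = (x <= y).
Proof. exact: lecR. Qed.

Lemma ltr_cplx (x y : R) : (cplx_of_real x < cplx_of_real y) = (x < y).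
Proof. exact: ltcR. Qed.

(** Nonnegative elements of [cplx R] are real; this turns each epsilon of the
complex topology into one of R. *)
Lemma cplx_ge0 (x : C) : 0 <= x -> x = cplx_of_real (complex.Re x).
Proof. by case: x => a b; rewrite lecE /= => /andP[/eqP -> _]. Qed.

Lemma cplx_norm_sum (z : C) :
  `|z| <= cplx_of_real (`|complex.Re z| + `|complex.Im z|).
Proof.
rewrite [X in `|X|](complexE z) cplx_of_realD.
apply: (le_trans (ler_normD _ _)).
by rewrite normrM cplx_norm_i mul1r !cplx_norm_real.
Qed.

Lemma cplx_Re_norm (z : C) : cplx_of_real `|complex.Re z| <= `|z|.
Proof. exact: normc_ge_Re. Qed.

Lemma cplx_Im_norm (z : C) : cplx_of_real `|complex.Im z| <= `|z|.
Proof.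
have := cplx_Re_norm (z * 'i%C); rewrite ReiNIm normrN.
by rewrite normrM cplx_norm_i mulr1.
Qed.

(** The bound in [bounded_fun] is an element of the value field, here a complex
number that is only known to be real. *)
Lemma bounded_cplxP (T : Type) (f : T -> C) :
  bounded_fun f <-> exists m : R, forall x, `|f x| <= cplx_of_real m.
Proof.
split=> [[M [Mr bM]]|[m bm]].
  have [m Mm] : exists m : R, M < cplx_of_real m.
    exists (complex.Re M + 1); rewrite -[X in X < _](RRe_real Mr).
    by rewrite ltr_cplx ltrDl.
  by exists m => x; exact: bM Mm x I.
exists (cplx_of_real m); split.
  by apply/complex_realP; exists m.
by move=> M /ltW mM x _ /=; exact: le_trans (bm x) mM.
Qed.

(** The real and imaginary parts stay in a segment, which is compact, so each of
them converges along U. *)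
Lemma cplx_ultra_cvg (T : Type) (U : set_system T) (UU : UltraFilter U)
    (f : T -> C) : bounded_fun f -> cvg (f @ U).
Proof.
move=> /bounded_cplxP[m bm].
have [a fa] : exists a : R, complex.Re (f x) @[x --> U] --> a.
  apply: (@ultra_bounded_cvg _ _ _ _ _ m) => x /=.
  by rewrite -ler_cplx; exact: le_trans (cplx_Re_norm _) (bm x).
have [b fb] : exists b : R, complex.Im (f x) @[x --> U] --> b.
  apply: (@ultra_bounded_cvg _ _ _ _ _ m) => x /=.
  by rewrite -ler_cplx; exact: le_trans (cplx_Im_norm _) (bm x).
apply/cvg_ex; exists (a +i* b)%C.
apply/cvgrPdist_lt => /= e e0.
have := cplx_ge0 (ltW e0); move: (complex.Re e) => r er.
have r20 : 0 < r / 2 by rewrite divr_gt0 // -ltr_cplx -er.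
move/cvgrPdist_lt: fa => /(_ _ r20) fa; move/cvgrPdist_lt: fb => /(_ _ r20) fb.
near=> x; apply: le_lt_trans (cplx_norm_sum _) _.
rewrite er ltr_cplx (splitr r).
have -> : complex.Re ((a +i* b)%C - f x) = a - complex.Re (f x) by case: (f x).
have -> : complex.Im ((a +i* b)%C - f x) = b - complex.Im (f x) by case: (f x).
by rewrite ltrD //; near: x.
Unshelve. all: by end_near. Qed.

End ComplexNumbers.

(** * Characters given by ultrafilters *)

Section BoundedContinuous.
Context {R : realType} (X : topologicalType).
Local Notation C := (cplx R).

(** Hence the algebra generated by a set of bounded continuous functions consists
of such functions.  Closedness is the epsilon/3 argument for
uniform limits. *)
Lemma Cb_closed_star_subalgebra : closed_star_subalgebra (@Cb R X).
Proof.
split; split=> //.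
- split; first exact: cst_continuous.
  by apply/bounded_cplxP; exists 0 => x; rewrite normr0.
- move=> f clf.
  have near_Cb (e : C) : 0 < e ->
      exists2 g, @Cb R X g & forall x, `|f x - g x| < e.
    move=> e0; have [|g [Cg fg]] := clf [set g | forall x, `|f x - g x| < e].
      apply/uniform_nbhs; exists [set xy | ball xy.1 e xy.2]; split.
        exact: (entourage_ball _ (PosNum e0)).
      by move=> g /= fg x; have := fg x I; rewrite -ball_normE.
    by exists g.
  split.
    move=> x; apply/cvgrPdist_lt => e e0.
    have e30 : 0 < e / 3%:R by rewrite divr_gt0.
    have [g [cg _] fg] := near_Cb _ e30.
    have /cvgrPdist_lt/(_ _ e30) := cg x.
    apply: filterS => y gxy.
    have -> : f x - f y = (f x - g x) + (g x - g y) + (g y - f y).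
      by rewrite !addrA !subrK.
    have -> : e = e / 3%:R + e / 3%:R + e / 3%:R by field.
    rewrite (le_lt_trans (ler_normD _ _)) // ltrD //; last by rewrite distrC.
    by rewrite (le_lt_trans (ler_normD _ _)) // ltrD.
  apply/bounded_cplxP.
  have [g [_ /bounded_cplxP[m gm]] fg] := near_Cb 1 ltr01.
  exists (1 + m) => x.
  rewrite -(subrK (g x) (f x)) cplx_of_realD (le_trans (ler_normD _ _)) //.
  by rewrite lerD // ltW.
- move=> f g [cf /bounded_cplxP[m fm]] [cg /bounded_cplxP[n gn]]; split.
    by move=> x; apply: cvgD; [exact: cf|exact: cg].
  apply/bounded_cplxP; exists (m + n) => x.
  rewrite cplx_of_realD (le_trans (ler_normD _ _)) //.
  by rewrite lerD.
- move=> a f [cf /bounded_cplxP[m fm]]; split.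
    by move=> x; apply: cvgM; [exact: cvg_cst|exact: cf].
  have := cplx_ge0 (normr_ge0 a); move: (complex.Re _) => k ak.
  apply/bounded_cplxP; exists (k * m) => x.
  rewrite normrM cplx_of_realM -ak.
  by rewrite ler_wpM2l.
- move=> f g [cf /bounded_cplxP[m fm]] [cg /bounded_cplxP[n gn]]; split.
    by move=> x; apply: cvgM; [exact: cf|exact: cg].
  apply/bounded_cplxP; exists (m * n) => x.
  by rewrite normrM cplx_of_realM ler_pM.
- move=> f [cf /bounded_cplxP[m fm]]; split.
    move=> x; apply/cvgrPdist_lt => e e0.
    have /cvgrPdist_lt/(_ _ e0) := cf x.
    by apply: filterS => y; rewrite -rmorphB norm_conjC.
  by apply/bounded_cplxP; exists m => x; rewrite norm_conjC.
Qed.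

End BoundedContinuous.

Section UltrafilterCharacter.
Context {R : realType} (X : topologicalType).
Local Notation C := (cplx R).
Variables (A : set (X -> C)) (U : set_system X) (UU : UltraFilter U).

Definition ultra_eval : {ptws set_type A -> C} := fun f => lim (\val f @ U).

Lemma ultra_eval_cvg (f : set_type A) :
  A `<=` @Cb R X -> \val f @ U --> ultra_eval f.
Proof.
by move=> ACb; apply: cplx_ultra_cvg; case: (ACb (\val f) (set_valP f)).
Qed.

(** Limits commute with the operations, and the constant 1 has limit 1. *)
Lemma ultra_eval_character : A `<=` @Cb R X -> A (cst 1) ->
  character ultra_eval.
Proof.
move=> ACb A1.
have lE (f : X -> C) l : f @ U --> l -> lim (f @ U) = l.
  by move=> fl; apply: cvg_lim => //; exact: norm_hausdorff.
split.
- move=> f g h hE; apply: lE.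
  rewrite (_ : \val h = fun x => \val f x + \val g x).
    by apply: cvgD; exact: ultra_eval_cvg.
  exact/funext.
- move=> a f h hE; apply: lE.
  rewrite (_ : \val h = fun x => a * \val f x).
    by apply: cvgM; [exact: cvg_cst|exact: ultra_eval_cvg].
  exact/funext.
- move=> f g h hE; apply: lE.
  rewrite (_ : \val h = fun x => \val f x * \val g x).
    by apply: cvgM; exact: ultra_eval_cvg.
  exact/funext.
- exists (exist _ (cst 1) (mem_set A1)).
  rewrite [ultra_eval _](_ : _ = 1) ?oner_neq0 //.
  by apply: lE; exact: cvg_cst.
Qed.

(** The spectrum carries the topology of pointwise convergence on A. *)
Lemma spectrum_eval_continuous (f : set_type A) :
  continuous (fun chi : spectrum A => \val chi f).
Proof.
move=> chi.
apply: (@cvg_comp _ _ _ (fun x : spectrum A => \val x)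
  (fun g : {ptws set_type A -> C} => g f) _
  (nbhs (\val chi : {ptws set_type A -> C}))).
  exact: (@initial_continuous _ _ (@set_val _ (@character R X A))).
exact: (@proj_continuous (set_type A) (fun=> C) f).
Qed.

End UltrafilterCharacter.

(** * Limit points in the metric compactification *)

Section MetricAlgebra.
Context {R : realType} (X : metricType R).
Local Notation C := (cplx R).

Lemma mdist_lipschitz (x x' y : X) : `|mdist x y - mdist x' y| <= mdist x x'.
Proof.
have := metric_triangle x x' y; have := metric_triangle x' x y.
by rewrite (metric_sym x' x) ler_norml => *; apply/andP; split; lra.
Qed.

(** By the triangle inequality, phi y z is bounded by d(y,z), and it is
2-Lipschitz. *)
Lemma phi_Cb (y z : X) : Cb (phi y z).
Proof.
split.
  move=> x; apply/cvgrPdist_lt => e e0.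
  have := cplx_ge0 (ltW e0); move: (complex.Re e) => r er.
  have r20 : 0 < r / 2 by rewrite divr_gt0 // -ltr_cplx -er.
  have : nbhs x (ball x (r / 2)) by exact: nbhsx_ballx.
  apply: filterS => x'; rewrite ballEmdist /= => xx'.
  rewrite /phi -cplx_of_realB cplx_norm_real er ltr_cplx.
  have := mdist_lipschitz x x' y; have := mdist_lipschitz x x' z.
  rewrite !ler_norml !ltr_norml => /andP[? ?] /andP[? ?].
  by apply/andP; split; lra.
apply/bounded_cplxP; exists (mdist y z) => x; rewrite cplx_norm_real ler_cplx.
by rewrite (metric_sym x y) (metric_sym x z) mdist_lipschitz.
Qed.

Lemma metric_algebra_Cb : @metric_algebra R X `<=` @Cb R X.
Proof.
apply: smallest_sub; first exact: Cb_closed_star_subalgebra.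
move=> f [[[]//|[c _ <-]]|[[y z] _ <-]]; last exact: phi_Cb.
split; first exact: cst_continuous.
have := cplx_ge0 (normr_ge0 c); move: (complex.Re _) => k ck.
by apply/bounded_cplxP; exists k => x; rewrite ck.
Qed.

Lemma metric_algebra_cst (c : C) : @metric_algebra R X (cst c).
Proof. by move=> A [_]; apply; left; right; exists c. Qed.

Lemma metric_algebra_phi (y z : X) : @metric_algebra R X (phi y z).
Proof. by move=> A [_]; apply; right; exists (y, z). Qed.

Lemma metric_algebra_Cinfty : @Cinfty R X `<=` @metric_algebra R X.
Proof. by move=> f fC A [_]; apply; left; left. Qed.

Variables (U : set_system X) (UU : UltraFilter U).

Definition ultra_point : metric_compactification X :=
  exist _ (@ultra_eval R X (@metric_algebra R X) U)
    (mem_set (ultra_eval_character UU metric_algebra_Cb (metric_algebra_cst 1))).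

Lemma ultra_point_cvg (f : set_type (@metric_algebra R X)) :
  \val f @ U --> \val ultra_point f.
Proof. exact: ultra_eval_cvg metric_algebra_Cb. Qed.

(** Both a ray converging to this point and the ultrafilter U send f to
neighbourhoods of the same number, the value of the point at f. *)
Lemma ray_ultra_close (T : set R) (gamma : R -> X) (f : X -> C) (e : C) :
  metric_algebra f -> 0 < e -> ray_converges T gamma ultra_point ->
  exists M : R, forall t, T t -> M < t ->
    U [set v | `|f v - f (gamma t)| < e].
Proof.
move=> fA e0 gU.
pose F : set_type (@metric_algebra R X) := exist _ f (mem_set fA).
have e20 : 0 < e / 2 by rewrite divr_gt0.
have /cvgrPdist_lt/(_ _ e20) Uf := @ultra_point_cvg F.
have : (\val (point_evaluation (gamma t)) F) @[t --> within T (pinfty_nbhs R)]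
    --> \val ultra_point F.
  exact: (cvg_comp _ _ gU (@spectrum_eval_continuous R X _ F ultra_point)).
move=> /cvgrPdist_lt/(_ _ e20)[M [_ Mf]]; exists M => t Tt Mt.
apply: filterS Uf => v /= vf.
rewrite -(subrKA (\val ultra_point F)) (splitr e).
rewrite (le_lt_trans (ler_normD _ _)) // ltrD //; first by rewrite distrC.
exact: Mf Mt Tt.
Qed.

(** The indicator function of an isolated point x vanishes at infinity, and it
separates evaluation at x from a limit along sets that avoid x. *)
Lemma ultra_point_boundary : (forall x : X, nbhs x [set x]) ->
  (forall x : X, U (~` [set x])) -> metric_boundary ultra_point.
Proof.
move=> isol Ux [x _ xU].
pose f (y : X) : C := (y == x)%:R.
have fA : metric_algebra f.
  apply: metric_algebra_Cinfty; split; [split|].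
  - move=> y B fB; apply: filterS (isol y) => z ->.
    exact: (nbhs_singleton fB).
  - apply/bounded_cplxP; exists 1 => y.
    by rewrite /f; case: eqP; rewrite ?normr1 ?normr0 ?ler_cplx //; exact: ler01.
  - move=> e e0; have [e1|e1] := boolP (e <= 1).
      rewrite (_ : [set _ | _] = [set x]); first exact: compact_set1.
      apply/seteqP; split=> y /=; rewrite /f.
        by case: eqP => // _; rewrite normr0 (lt_geF e0).
      by move=> ->; rewrite eqxx normr1.
    rewrite (_ : [set _ | _] = set0); first exact: compact0.
    apply/seteqP; split=> y //=; rewrite /f; case: eqP => _ /=.
      by rewrite normr1; apply/negP.
    by rewrite normr0 (lt_geF e0).
pose F : set_type (@metric_algebra R X) := exist _ f (mem_set fA).
have := @ultra_point_cvg F; rewrite -xU => /cvgrPdist_lt/(_ _ ltr01) fU.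
have [v [/= + vx]] := filter_ex (filterI fU (Ux x)).
by rewrite /eval_at /= /f eqxx; case: eqP => //; rewrite subr0 normr1 ltxx.
Qed.

End MetricAlgebra.

(** * Minimal paths and almost-geodesic rays in a graph *)

Lemma natr_dist_lt1 (R : realType) (m n : nat) :
  `|m%:R - n%:R| < 1 :> R -> m = n.
Proof.
by rewrite ltr_distl ltrBlDr !natr1 !ltr_nat => /andP[]; lia.
Qed.

Section GraphPart.
Context (R : realType) (V : choiceType) (G : connected_graph V).
Local Notation X := (graph_space R G).
Local Notation d := (gdist G).

Lemma graph_space_isolated (x : X) : nbhs x [set x].
Proof.
have : nbhs x (ball x (1 : R)) by exact: nbhsx_ballx.
apply: filterS => y; rewrite ballEmdist /= => xy.
apply/esym; apply: (@gdist_eq0 _ G); apply/eqP; rewrite -leqn0 -ltnS.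
by rewrite -(ltr_nat R).
Qed.

(** The common tail is one minimal path from x to v, appended to minimal paths
from a and from b to x. *)
Lemma gdist_tail_shared (a b x v : V) : v <> x ->
  d a v = (d a x + d x v)%N -> d b v = (d b x + d x v)%N ->
  exists p q, [/\ minimal_path G a v p, minimal_path G b v q
                & share_tail (a :: p) (b :: q)].
Proof.
move=> vx av bv.
have [r [xr rv sr]] := gdist_path G x v.
have ext c : d c v = (d c x + d x v)%N ->
    exists2 p, minimal_path G c v p & suffix (x :: r) (c :: p).
  move=> cv; have [p [cp px sp]] := gdist_path G c x.
  exists (p ++ r).
    by split; rewrite ?cat_path ?last_cat ?px ?cp ?size_cat ?sp ?sr.
  by rewrite -cat_cons (lastI c p) px cat_rcons suffix_suffix.
have [p ap xp] := ext a av; have [q bq xq] := ext b bv.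
exists p, q; split=> //; exists (x :: r); split=> //=.
by case: (r) rv => [/esym/vx|].
Qed.

(** Integer values of phi that are closer than 1 agree; the equation is written
with natural numbers, negative terms being moved across. *)
Lemma phi_close_gdist (y z v w : V) :
  `|phi (y : X) z v - phi (y : X) z w| < 1 -> (d v y + d w z = d w y + d v z)%N.
Proof.
rewrite /phi -cplx_of_realB cplx_norm_real.
rewrite (_ : 1 = cplx_of_real 1) // ltr_cplx => vw.
apply: (@natr_dist_lt1 R); apply: le_lt_trans vw.
by rewrite le_eqVlt !natrD; apply/orP; left; apply/eqP; congr `|_|; ring.
Qed.

(** Take epsilon = 1/2 in the definition, for the pair (t, s) and for the pair
(t, t): the latter says that d(gamma t, gamma 0) is within 1/2 of t. *)
Lemma almost_geodesic_gdist (T : set R) (gamma : R -> X) :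
  almost_geodesic_ray T gamma -> exists M : R, forall s t : R,
    T s -> T t -> M < s -> s <= t ->
    (d (gamma t) (gamma s) + d (gamma s) (gamma 0%R) = d (gamma t) (gamma 0%R))%N.
Proof.
move=> [_ _ _ /(_ (1 / 2))[|N ray]]; first by lra.
exists N%:~R => s t Ts Tt /ltW Ns st; apply: (@natr_dist_lt1 R).
have := ray t s Tt Ts st Ns; have := ray t t Tt Tt (lexx _) (le_trans Ns st).
rewrite /mdist /= gdistxx add0r natrD.
rewrite !ltr_norml => /andP[? ?] /andP[? ?]; apply/andP; split; lra.
Qed.

(** Write g = gamma 0, x = gamma s, and let v be near the limit.  The function phi x g takes the
same value at v and at some gamma t far along the ray, and phi a g takes the same
value at v and already at x.  As gamma t lies beyond x on a geodesic from g, the first gives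
d(g,v) = d(g,x) + d(x,v); the second gives d(a,v) - d(g,v) = d(a,x) - d(g,x).
Adding up yields d(a,v) = d(a,x) + d(x,v). *)
Lemma geodesic_toward_limit (U : set_system X) (UU : UltraFilter U)
    (T : set R) (gamma : R -> X) (a : V) :
  almost_geodesic_ray T gamma -> ray_converges T gamma (ultra_point UU) ->
  exists M : R, forall s, T s -> M < s ->
    U [set v | d a v = (d a (gamma s) + d (gamma s) v)%N].
Proof.
move=> ray gU; have [N Ngeo] := almost_geodesic_gdist ray.
have close y z : exists M : R, forall t, T t -> M < t ->
    U [set v | (d v y + d (gamma t) z = d (gamma t) y + d v z)%N].
  have [M UM] := ray_ultra_close (metric_algebra_phi (y : X) z) ltr01 gU.
  by exists M => t Tt /(UM t Tt); apply: filterS => v; exact: phi_close_gdist.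
have [M HM] := close a (gamma 0%R); exists (Num.max M N) => s Ts.
rewrite gt_max => /andP[Ms Ns].
(* gamma t must lie beyond gamma s, and far enough for phi (gamma s) (gamma 0)
   to have settled; how far depends on s. *)
have [K HK] := close (gamma s) (gamma 0%R).
have [_ _ unbounded _] := ray.
have [t Tt] := unbounded (Num.max K s); rewrite gt_max => /andP[Kt st].
have := Ngeo s t Ts Tt Ns (ltW st) => E.
apply: filterS2 (HM s Ts Ms) (HK t Tt Kt) => v /= E1 E2.
by rewrite !(gdist_sym G _ v) (gdist_sym G a); lia.
Qed.

End GraphPart.

(** * A boundary point that is not a Busemann point *)

Theorem theorem2p2 (R : realType) (V : countType) (G : connected_graph V)
    (Gfin : locally_finite G)
    (Gtriangles : exists a b : V, forall n : nat, exists c : V,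
      (n <= gdist G a b + gdist G b c + gdist G c a)%N /\
      forall p q : seq V, minimal_path G a c p -> minimal_path G b c q ->
        ~ share_tail (a :: p) (b :: q)) :
  exists omega : metric_compactification (graph_space R G),
    metric_boundary omega /\ ~ busemann_point omega.
Proof.
have [a [b /choice[c cP]]] := Gtriangles.
have [U [UU cU]] := ultraFilterLemma (fmap_proper_filter c eventually_filter).
have Ur : U (range c) by apply: cU; exists 0%N => // n _; exists n.
(* The perimeter of (a, b, x) is at most 2 (d(a,b) + d(a,x)), so c_n = x for only
   finitely many n. *)
have Ux (x : graph_space R G) : U (~` [set x]).
  apply: cU; exists (2 * (gdist G a b + gdist G a x)).+1 => // n /= xn cx.
  have [] := cP n; rewrite cx (gdist_sym G x a).
  have := gdist_triangle G a b x; rewrite (gdist_sym G b a); lia.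
exists (ultra_point (X := graph_space R G) UU); split.
  by apply: ultra_point_boundary => // x; exact: graph_space_isolated.
move=> [_ [T [gamma [ray gU]]]].
have [M HM] := geodesic_toward_limit a ray gU.
have [N HN] := geodesic_toward_limit b ray gU.
have [_ _ unbounded _] := ray.
have [s Ts] := unbounded (Num.max M N); rewrite gt_max => /andP[Ms Ns].
have [v [[[/= av bv] vx] [n _ cn]]] := filter_ex
  (filterI (filterI (filterI (HM s Ts Ms) (HN s Ts Ns)) (Ux (gamma s))) Ur).
have [p [q [ap bq]]] := gdist_tail_shared vx av bv.
by have [_] := cP n; rewrite cn; apply.
Qed.
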